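(* Let $F$ be a formally real field (so in particular of characteristic $0$), and let $\mathcal{G}_F$ be its W-group with Frattini subgroup $\Phi(\mathcal{G}_F)$. Then $\Phi(\mathcal{G}_F)$ is a central elementary abelian $2$-subgroup of $\mathcal{G}_F$, and it has index two in every maximal elementary abelian subgroup of $\mathcal{G}_F$.
   Context: For a field $F$ of characteristic $\neq 2$, let $F_q$ be its quadratic closure and $G_F=\mathrm{Gal}(F_q/F)$. The W-group of $F$ is $\mathcal{G}_F=G_F/G_F^4[G_F^2,G_F]$, where $G_F^4[G_F^2,G_F]$ is the closed subgroup generated by all fourth powers and all commutators $[x^2,y]$, $x,y\in G_F$. $\Phi(\mathcal{G}_F)$ denotes the (closed) Frattini subgroup of the pro-$2$-group $\mathcal{G}_F$. A field is formally real if $-1$ is not a sum of squares in it. *)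

(* Defs.v *)
From HB Require Import structures.
From mathcomp Require Import all_boot all_order all_algebra.
From mathcomp Require Import monoid.
Set Implicit Arguments. Unset Strict Implicit. Unset Printing Implicit Defensive.
Import GRing.Theory.

Section Defs.

Definition formally_real (F : fieldType) : Prop :=
  ~ exists s : seq F, (\sum_(x <- s) x ^+ 2 = - 1)%R.

Variables (F L : fieldType) (iota : {rmorphism F -> L}).

Definition subfield_over (K : L -> Prop) : Prop :=
  (forall a, K (iota a)) /\
  (forall x y, K x -> K y -> K (x + y)%R) /\
  (forall x, K x -> K (- x)%R) /\
  (forall x y, K x -> K y -> K (x * y)%R) /\
  (forall x, K x -> K (x^-1)%R).

Definition quad_closed (K : L -> Prop) : Prop :=
  forall a b, K a -> K b -> exists x, K x /\ (x ^+ 2 + a * x + b = 0)%R.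

Definition quadratic_closure : Prop :=
  quad_closed (fun _ => True) /\
  forall K, subfield_over K -> quad_closed K -> forall x, K x.

Definition is_aut (s : L -> L) : Prop :=
  (forall x y, s (x + y)%R = (s x + s y)%R) /\
  (forall x y, s (x * y)%R = (s x * s y)%R) /\
  s 1%R = 1%R /\ bijective s /\ (forall a, s (iota a) = iota a).

Definition krull_open (V : (L -> L) -> Prop) : Prop :=
  forall s, V s -> exists S : seq L,
    forall t, is_aut t -> (forall x, x \in S -> t x = s x) -> V t.

Definition krull_closed (X : (L -> L) -> Prop) : Prop :=
  forall s, is_aut s ->
    (forall S : seq L, exists t, X t /\ forall x, x \in S -> t x = s x) ->
    X s.

Definition aut_subgroup (H : (L -> L) -> Prop) : Prop :=
  (forall s, H s -> is_aut s) /\ H id /\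
  (forall s t, H s -> H t -> H (s \o t)) /\
  (forall s t, H s -> is_aut t -> s \o t =1 id -> H t).

(* generators x^4 and [x^2, y] = x^-2 y^-1 x^2 y  (c = [x^2,y] iff
   y x^2 c = x^2 y) *)
Definition W_gens (c : L -> L) : Prop :=
  is_aut c /\
  ((exists x, is_aut x /\ c =1 x \o x \o x \o x) \/
   (exists x y, is_aut x /\ is_aut y /\ y \o (x \o x) \o c =1 (x \o x) \o y)).

(* N = G_F^4 [G_F^2, G_F]: the closed subgroup generated by W_gens *)
Definition W_kernel (s : L -> L) : Prop :=
  forall H, aut_subgroup H -> krull_closed H ->
    (forall g, W_gens g -> H g) -> H s.

Definition W_group_quotient (W : groupType) (pi : (L -> L) -> W) : Prop :=
  (forall s t, is_aut s -> is_aut t -> pi (s \o t) = (pi s * pi t)%g) /\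
  (forall w, exists s, is_aut s /\ pi s = w) /\
  (forall s, is_aut s -> (pi s = 1%g <-> W_kernel s)).

Definition W_open (W : groupType) (pi : (L -> L) -> W) (U : W -> Prop) : Prop :=
  krull_open (fun s => is_aut s /\ U (pi s)).

End Defs.

Section GroupDefs.
Variable W : groupType.

Definition subgroup (H : W -> Prop) : Prop :=
  H 1%g /\ (forall x y, H x -> H y -> H (x * y)%g) /\ (forall x, H x -> H (x^-1)%g).

Definition maximal_open_subgroup (op : (W -> Prop) -> Prop) (M : W -> Prop) : Prop :=
  subgroup M /\ op M /\ (exists w, ~ M w) /\
  forall H, subgroup H -> (forall x, M x -> H x) ->
    (forall x, H x -> M x) \/ (forall x, H x).

Definition frattini (op : (W -> Prop) -> Prop) (w : W) : Prop :=
  forall M, maximal_open_subgroup op M -> M w.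

Definition central (H : W -> Prop) : Prop :=
  forall x y, H x -> (x * y = y * x)%g.

Definition elementary_abelian2 (H : W -> Prop) : Prop :=
  subgroup H /\ (forall x y, H x -> H y -> (x * y = y * x)%g) /\
  (forall x, H x -> (x ^+ 2 = 1)%g).

Definition maximal_elementary_abelian (A : W -> Prop) : Prop :=
  elementary_abelian2 A /\
  forall B, elementary_abelian2 B -> (forall x, A x -> B x) -> forall x, B x -> A x.

Definition index_two_in (H A : W -> Prop) : Prop :=
  (forall x, H x -> A x) /\
  exists a, A a /\ ~ H a /\ forall b, A b -> H b \/ H (a^-1 * b)%g.

End GroupDefs.

(* Main.v *)
Require Import Defs.
From HB Require Import structures.
From mathcomp Require Import all_boot all_order all_algebra.
From mathcomp Require Import monoid.
From mathcomp Require Import boolp classical_sets.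
From mathcomp Require Import ring.
Set Implicit Arguments. Unset Strict Implicit. Unset Printing Implicit Defensive.
Import GRing.Theory.


(* Let G = Aut(L/F), N the kernel of G -> W and F' the fixed field of G.  A
   proper open subgroup of G fixes some e outside F' with e^2 in F', because a
   subfield of L containing F' but no new square root of an element of F' is F'
   itself (norm argument along a tower of quadratic extensions).  Hence Phi
   consists of the classes of the automorphisms fixing all square roots of
   elements of F'; it is also contained in the central elements of exponent two,
   which form a closed subgroup containing all squares.

   N fixes the fourth roots of elements of F'.  If s^2 is in N, s moves e and
   s(i) = i, then s(b) = +-ib for b^2 = e, so s^2(b) = -b, which is impossible.
   So every involution of W outside Phi moves i, and two commuting ones agree
   modulo Phi, since their quotient fixes i.  Such an involution exists: a
   maximal formally real subfield K of L satisfies L = K(i), and conjugation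
   over K works. *)

(** * Zorn's lemma above a given predicate *)

Lemma zorn_above (T : Type) (Q : (T -> Prop) -> Prop) (base : T -> Prop) :
  Q base -> (exists x, base x) ->
  (forall C : (T -> Prop) -> Prop, (exists X, C X) -> (forall X, C X -> Q X) ->
    (forall X Y, C X -> C Y -> (forall x, X x -> Y x) \/ (forall x, Y x -> X x)) ->
    Q (fun x => exists2 X, C X & X x)) ->
  exists A, [/\ Q A, forall x, base x -> A x &
    forall B, Q B -> (forall x, A x -> B x) -> forall x, B x -> A x].
Proof.
move=> Qb [x0 bx0] Qch.
pose P (A : set T) := A = set0 \/ Q A /\ subset base A.
have [|A [PA maxA]] := @Zorn_bigcup T P.
  move=> D DP Dtot.
  have [[X1 [DX1 X1n]]|noX] := pselect (exists X1, D X1 /\ X1 <> set0); last first.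
    left; rewrite -subset0 => x [X DX Xx].
    by case: noX; exists X; split=> // XE; rewrite XE in Xx.
  right; split; last first.
    by move=> x bx; exists X1 => //; case: (DP _ DX1) => [//|[_]]; apply.
  have -> : bigcup D id = (fun x => exists2 X, D X /\ X <> set0 & X x).
    apply/funext => x; apply/propext; split=> [[X DX Xx]|[X [DX _] Xx]].
      by exists X => //; split=> // XE; rewrite XE in Xx.
    by exists X.
  apply: Qch; first by exists X1.
    by move=> X [DX Xn]; case: (DP _ DX) => [//|[]].
  by move=> X Y [DX _] [DY _]; exact: Dtot.
case: PA => [AE|[QA bA]].
  case: (maxA base); last by right; split.
  by rewrite AE; split=> // b0; exact: (b0 x0).
exists A; split=> // B QB AB.
apply: contrapT => nBA; apply: (maxA B); first by split.
by right; split=> // x /bA /AB.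
Qed.

(** * Quadratic towers *)

Section Subfields.
Variables (F L : fieldType) (iota : {rmorphism F -> L}).
Local Open Scope ring_scope.
Implicit Types (K E M : L -> Prop) (r : L).

Notation subfield := (subfield_over iota).

Lemma subfieldB K x y : subfield K -> K x -> K y -> K (x - y).
Proof. by move=> [_ [KD [KN _]]] Kx Ky; apply/KD/KN. Qed.

Lemma subfield0 K : subfield K -> K 0.
Proof. by move=> [Ki _]; rewrite -(rmorph0 iota). Qed.

Lemma subfield1 K : subfield K -> K 1.
Proof. by move=> [Ki _]; rewrite -(rmorph1 iota). Qed.

Lemma subfield_div K x y : subfield K -> K x -> K y -> K (x / y).
Proof. by move=> [_ [_ [_ [KM KV]]]] Kx Ky; apply/KM/KV. Qed.

Lemma subfieldX K x n : subfield K -> K x -> K (x ^+ n).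
Proof.
move=> sK Kx; elim: n => [|n IHn]; first exact: subfield1.
by case: (sK) => _ [_ [_ [KM _]]]; rewrite exprS; exact: KM.
Qed.

Lemma subfield_chain (C : (L -> Prop) -> Prop) :
  (exists K, C K) -> (forall K, C K -> subfield K) ->
  (forall K K', C K -> C K' -> (forall x, K x -> K' x) \/ (forall x, K' x -> K x)) ->
  subfield (fun x => exists2 K, C K & K x).
Proof.
move=> [K0 CK0] sC totC.
have common x y : (exists2 K, C K & K x) -> (exists2 K, C K & K y) ->
    exists2 K, C K & K x /\ K y.
  move=> [K CK Kx] [K' CK' Ky].
  by case: (totC _ _ CK CK') => sub; [exists K'|exists K] => //; split=> //; exact: sub.
split; first by move=> a; exists K0 => //; case: (sC _ CK0).
split.
  move=> x y Cx Cy; have [K CK [Kx Ky]] := common _ _ Cx Cy.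
  by exists K => //; case: (sC _ CK) => _ [KD _]; exact: KD.
split.
  by move=> x [K CK Kx]; exists K => //; case: (sC _ CK) => _ [_ [KN _]]; exact: KN.
split.
  move=> x y Cx Cy; have [K CK [Kx Ky]] := common _ _ Cx Cy.
  by exists K => //; case: (sC _ CK) => _ [_ [_ [KM _]]]; exact: KM.
by move=> x [K CK Kx]; exists K => //; case: (sC _ CK) => _ [_ [_ [_ KV]]]; exact: KV.
Qed.

(** This is the field [K(r)] as soon as [r^2] lies in [K]; it is kept as a plain set of sums
    [u + v r], also when [r] is in [K] and the coordinates are not unique. *)
Definition adj K r (x : L) : Prop := exists u v, [/\ K u, K v & x = u + v * r].

Lemma adj_base K r x : subfield K -> K x -> adj K r x.
Proof.
by move=> sK Kx; exists x, 0; split=> //; [exact: subfield0|rewrite mul0r addr0].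
Qed.

Lemma adj_gen K r : subfield K -> adj K r r.
Proof.
move=> sK; exists 0, 1; split; [exact: subfield0|exact: subfield1|].
by rewrite mul1r add0r.
Qed.

Lemma adj_mono K M r x : (forall y, K y -> M y) -> adj K r x -> adj M r x.
Proof. by move=> KM [u [v [Ku Kv ->]]]; exists u, v; split=> //; exact: KM. Qed.

Lemma adj_trivial K r x : subfield K -> K r -> adj K r x -> K x.
Proof.
by move=> [_ [KD [_ [KM _]]]] Kr [u [v [Ku Kv ->]]]; apply/KD => //; exact: KM.
Qed.

Lemma adj_coord K r u v u' v' : subfield K -> ~ K r ->
  K u -> K v -> K u' -> K v' -> u + v * r = u' + v' * r -> u = u' /\ v = v'.
Proof.
move=> sK nKr Ku Kv Ku' Kv' E.
have vE : v = v'.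
  apply: contrapT => /eqP nv; apply: nKr.
  have nv' : v - v' != 0 by rewrite subr_eq0.
  have -> : r = (u' - u) / (v - v').
    have -> : u' - u = r * (v - v').
      by transitivity (u' + v' * r - (u + v' * r)); [ring|rewrite -E; ring].
    by rewrite mulfK.
  by apply: subfield_div => //; apply: subfieldB.
by split=> //; move: E; rewrite vE => /addIr.
Qed.

Lemma subfield_adj K r : subfield K -> K (r ^+ 2) -> subfield (adj K r).
Proof.
move=> sK Kr2; case: (sK) => [Ki [KD [KN [KM KV]]]].
split; first by move=> a; apply: adj_base.
split.
  move=> _ _ [u [v [Ku Kv ->]]] [u' [v' [Ku' Kv' ->]]].
  by exists (u + u'), (v + v'); split; [exact: KD|exact: KD|ring].
split.
  by move=> _ [u [v [Ku Kv ->]]]; exists (- u), (- v); split; [exact: KN|exact: KN|ring].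
split.
  move=> _ _ [u [v [Ku Kv ->]]] [u' [v' [Ku' Kv' ->]]].
  exists (u * u' + v * v' * r ^+ 2), (u * v' + v * u').
  split; [|by apply/KD; apply/KM|ring].
  by apply/KD; [|apply/KM => //]; apply/KM.
move=> x [u [v [Ku Kv xE]]].
have [->|x0] := eqVneq x 0; first by rewrite invr0; apply: adj_base => //; exact: subfield0 sK.
(* When [r] is in [K] the conjugate [u - v r] can vanish and the norm cannot be inverted; then
   [x = 2u] already lies in [K]. *)
have [E|y0] := eqVneq (u - v * r) 0.
  apply: adj_base => //; apply/KV.
  have -> : x = u + u by rewrite xE -{2}[u](subr0) -E; ring.
  exact: KD.
have Kd : K (u ^+ 2 - v ^+ 2 * r ^+ 2).
  by apply: subfieldB => //; [|apply/KM => //]; apply: subfieldX.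
have d0 : u ^+ 2 - v ^+ 2 * r ^+ 2 != 0.
  have -> : u ^+ 2 - v ^+ 2 * r ^+ 2 = x * (u - v * r) by rewrite xE; ring.
  by rewrite mulf_neq0.
exists (u / (u ^+ 2 - v ^+ 2 * r ^+ 2)), (- v / (u ^+ 2 - v ^+ 2 * r ^+ 2)).
split; [exact: subfield_div|by apply: subfield_div => //; exact: KN|].
rewrite xE in x0 *; field.
by rewrite x0 exprMn d0.
Qed.

(** The quadratic formula. With the minimality of [L] it shows that a subfield closed under square
    roots is all of [L]. *)
Lemma sqrt_quad_closed K : subfield K -> (2%:R : L) != 0 ->
  (forall a, K a -> exists2 r, K r & r ^+ 2 = a) -> quad_closed K.
Proof.
move=> sK two0 sqrtK a b Ka Kb; case: (sK) => [Ki [KD [KN [KM KV]]]].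
have K2 : K 2%:R by rewrite -(rmorph_nat iota).
have K4 : K 4%:R by rewrite -(rmorph_nat iota).
have [|r Kr rE] := sqrtK (a ^+ 2 - 4%:R * b).
  by apply: subfieldB => //; [exact: subfieldX|exact: KM].
exists ((r - a) / 2%:R); split; first by apply: subfield_div => //; exact: subfieldB.
have -> : ((r - a) / 2%:R) ^+ 2 + a * ((r - a) / 2%:R) + b =
    (r ^+ 2 - (a ^+ 2 - 4%:R * b)) / 4%:R.
  by field; rewrite two0 -[4%N]/(2 * 2)%N natrM mulf_neq0.
by rewrite rE subrr mul0r.
Qed.

Inductive tower (K0 : L -> Prop) : (L -> Prop) -> Prop :=
| tower_base : tower K0 K0
| tower_adj K r : tower K0 K -> K (r ^+ 2) -> tower K0 (adj K r).

Lemma tower_subfield K0 K : subfield K0 -> tower K0 K -> subfield K.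
Proof. by move=> sK0; elim=> // {}K r _ sK Kr2; exact: subfield_adj. Qed.

Lemma tower_sub K0 K : subfield K0 -> tower K0 K -> forall x, K0 x -> K x.
Proof.
move=> sK0; elim=> // {}K r tK sub Kr2 x K0x.
by apply: adj_base; [exact: tower_subfield tK|exact: sub].
Qed.

Lemma tower_join K0 K1 K2 : subfield K0 -> tower K0 K1 -> tower K0 K2 ->
  exists K, [/\ tower K0 K, forall x, K1 x -> K x & forall x, K2 x -> K x].
Proof.
move=> sK0 t1; elim=> [|K r tK [K' [tK' sub1 sub2]] Kr2].
  by exists K1; split=> //; exact: tower_sub.
exists (adj K' r); split; first by constructor=> //; exact: sub2.
  by move=> x /sub1; apply/adj_base/(tower_subfield sK0).
by move=> x; exact: adj_mono.
Qed.

Lemma quadratic_closure_sqrt : quadratic_closure iota -> forall a : L, exists r, r ^+ 2 = a.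
Proof.
move=> [qc _] a; have [r [_ rE]] := qc 0 (- a) I I.
exists r; move: rE; rewrite mul0r addr0 => /eqP; rewrite subr_eq0; exact: eqP.
Qed.

(** The elements lying in some tower form a subfield, since two towers can be joined, and this
    subfield is closed under square roots; minimality of [L] makes it everything. *)
Lemma quadratic_closure_tower K0 : quadratic_closure iota -> (2%:R : L) != 0 ->
  subfield K0 -> forall x, exists2 K, tower K0 K & K x.
Proof.
move=> qL two0 sK0; case: (qL) => _ minL.
have sT : subfield (fun x => exists2 K, tower K0 K & K x).
  have common x y : (exists2 K, tower K0 K & K x) -> (exists2 K, tower K0 K & K y) ->
      exists2 K, tower K0 K & [/\ subfield K, K x & K y].
    move=> [K tK Kx] [K' tK' Ky].
    have [K2 [tK2 sub sub']] := tower_join sK0 tK tK'.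
    exists K2 => //; split; [exact: tower_subfield tK2|exact: sub|exact: sub'].
  split; first by move=> a; exists K0; [constructor|case: sK0].
  split.
    move=> x y Tx Ty; have [K tK [[_ [KD _]] Kx Ky]] := common _ _ Tx Ty.
    by exists K => //; exact: KD.
  split.
    by move=> x Tx; have [K tK [[_ [_ [KN _]]] Kx _]] := common _ _ Tx Tx; exists K => //; exact: KN.
  split.
    move=> x y Tx Ty; have [K tK [[_ [_ [_ [KM _]]]] Kx Ky]] := common _ _ Tx Ty.
    by exists K => //; exact: KM.
  by move=> x Tx; have [K tK [[_ [_ [_ [_ KV]]]] Kx _]] := common _ _ Tx Tx; exists K => //; exact: KV.
apply: minL => //; apply: sqrt_quad_closed => // a [K tK Ka].
have [r rE] := quadratic_closure_sqrt qL a.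
exists r => //; exists (adj K r); first by constructor=> //; rewrite rE.
exact/adj_gen/(tower_subfield sK0).
Qed.

(* The norm from M(r) to M shows that K(r) stays closed under the square roots
   available in M(r). *)
Lemma adj_sqrt_closed K M r : subfield K -> subfield M -> (2%:R : L) != 0 ->
  (forall x, K x -> M x) -> (forall m, M m -> K (m ^+ 2) -> K m) ->
  K (r ^+ 2) -> ~ M r ->
  forall w, adj M r w -> adj K r (w ^+ 2) -> adj K r w.
Proof.
move=> sK sM two0 KM sqK Kr2 nMr w [e [f [Me Mf wE]]] [c [d [Kc Kd w2E]]].
case: (sK) => _ [KD [KN [KMul KV]]]; case: (sM) => _ [MD [MN [MMul MV]]].
have Mr2 := KM _ Kr2.
have [cE dE] : c = e ^+ 2 + f ^+ 2 * r ^+ 2 /\ d = 2%:R * e * f.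
  apply: (@adj_coord M r) => //; do ?[exact: KM].
  - by apply/MD; [|apply/MMul => //]; apply: subfieldX.
  - by do !apply/MMul => //; rewrite -(rmorph_nat iota); case: sM.
  - by rewrite -w2E wE; ring.
(* The norm of [w] is in [M] and its square is the norm of [w^2], which is in [K]; so the norm
   itself is in [K]. *)
have Kn : K (e ^+ 2 - f ^+ 2 * r ^+ 2).
  apply/sqK; first by apply: subfieldB => //; [|apply/MMul => //]; apply: subfieldX.
  have -> : (e ^+ 2 - f ^+ 2 * r ^+ 2) ^+ 2 = c ^+ 2 - d ^+ 2 * r ^+ 2.
    by rewrite cE dE; ring.
  by apply: subfieldB => //; [|apply/KMul => //]; apply: subfieldX.
have K2 : K 2%:R by rewrite -(rmorph_nat iota); case: sK.
have Ke : K e.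
  apply/sqK => //.
  have -> : e ^+ 2 = (c + (e ^+ 2 - f ^+ 2 * r ^+ 2)) / 2%:R by rewrite cE; field.
  by apply: subfield_div => //; exact: KD.
have r0 : r != 0 by apply/eqP => r0; apply: nMr; rewrite r0; exact: subfield0.
have Kf : K f.
  apply/sqK => //.
  have -> : f ^+ 2 = (c - e ^+ 2) / r ^+ 2 by rewrite cE; field.
  by apply: subfield_div => //; apply: subfieldB => //; exact: subfieldX.
by exists e, f.
Qed.

(** Along a tower over [K0], each [K] is paired with a field [M] containing [K] and [E], such that
    [M] holds no new square root of an element of [K] and [K] meets [E] only in [K0]. As the towers
    exhaust [L], this forces [E = K0]. *)
Lemma sqrt_closed_eq K0 E : quadratic_closure iota -> (2%:R : L) != 0 ->
  subfield K0 -> subfield E -> (forall x, K0 x -> E x) ->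
  (forall e, E e -> K0 (e ^+ 2) -> K0 e) -> forall x, E x -> K0 x.
Proof.
move=> qL two0 sK0 sE K0E sqK0.
have tow K : tower K0 K -> exists M, [/\ subfield M, forall x, K x -> M x,
    forall x, E x -> M x, forall m, M m -> K (m ^+ 2) -> K m &
    forall x, K x -> E x -> K0 x].
  elim=> [|{}K r tK [M [sM KM EM sqK KE]] Kr2]; first by exists E.
  have sK := tower_subfield sK0 tK.
  have [Kr|nKr] := pselect (K r).
    have -> : adj K r = K.
      apply/funext=> x; apply/propext; split; first exact: adj_trivial.
      exact: adj_base.
    by exists M.
  have nMr : ~ M r by move=> Mr; apply: nKr; exact: sqK.
  have sMr : subfield (adj M r) by apply: subfield_adj => //; exact: KM.
  exists (adj M r); split=> //.
  - by move=> x; exact: adj_mono.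
  - by move=> x /EM; exact: adj_base.
  - exact: adj_sqrt_closed.
  (* The elements [x], [u] and [v] lie in [M] and [r] does not, so the coordinate [v] vanishes. *)
  move=> x [u [v [Ku Kv xE]]] Ex; apply: KE => //.
  have [-> _] // : x = u /\ 0 = v.
  apply: (@adj_coord M r) => //; do ?[exact: KM|exact: EM|exact: subfield0].
  by rewrite mul0r addr0.
move=> x Ex; have [K tK Kx] := quadratic_closure_tower qL two0 sK0 x.
by have [M [_ _ _ _]] := tow K tK; apply.
Qed.

End Subfields.

(** * Automorphisms and fixed fields *)

Section Automorphisms.
Variables (F L : fieldType) (iota : {rmorphism F -> L}).
Local Open Scope ring_scope.
Implicit Types (s t : L -> L) (M : (L -> L) -> Prop) (x e : L).

Notation aut := (is_aut iota).

Lemma aut_rmorphism s : aut s -> exists f : {rmorphism L -> L}, s = f :> (L -> L).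
Proof.
move=> [sD [sM [s1 _]]].
have sB : zmod_morphism s.
  move=> x y; have s0 : s 0 = 0 by apply: (addIr (s 0)); rewrite -sD !add0r.
  rewrite sD; congr (_ + _); apply: (addIr (s y)).
  by rewrite -sD !addNr.
pose iZ := GRing.isZmodMorphism.Build L L s sB.
pose iM := GRing.isMonoidMorphism.Build L L s (s1, sM).
pose f : {rmorphism L -> L} := HB.pack s iZ iM.
by exists f.
Qed.

Lemma aut_id : aut id.
Proof. by do !split=> //; exists id. Qed.

Lemma aut_comp s t : aut s -> aut t -> aut (s \o t).
Proof.
move=> [sD [sM [s1 [sb si]]]] [tD [tM [t1 [tb ti]]]].
split; first by move=> x y /=; rewrite tD sD.
split; first by move=> x y /=; rewrite tM sM.
by split; rewrite /= ?t1 ?s1 //; split; [exact: bij_comp|move=> a /=; rewrite ti si].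
Qed.

Lemma aut_inverse s : aut s -> exists t, [/\ aut t, cancel s t & cancel t s].
Proof.
move=> [sD [sM [s1 [[t st ts] si]]]]; exists t; split=> //.
split; first by move=> x y; apply: (can_inj st); rewrite sD !ts.
split; first by move=> x y; apply: (can_inj st); rewrite sM !ts.
split; first by rewrite -s1 st.
by split; [exists s|move=> a; apply: (can_inj st); rewrite ts si].
Qed.

Lemma aut_inj s : aut s -> injective s.
Proof. by move=> [_ [_ [_ [/bij_inj]]]]. Qed.

Lemma autX s (sA : aut s) x n : s (x ^+ n) = s x ^+ n.
Proof. by have [f ->] := aut_rmorphism sA; rewrite rmorphXn. Qed.

Lemma autN s (sA : aut s) x : s (- x) = - s x.
Proof. by have [f ->] := aut_rmorphism sA; rewrite rmorphN. Qed.

Lemma autM s (sA : aut s) x y : s (x * y) = s x * s y.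
Proof. by case: sA => [_ [sM _]]. Qed.

Definition fixed_field M x := forall s, M s -> s x = x.

Lemma fixed_field_subfield M : (forall s, M s -> aut s) ->
  subfield_over iota (fixed_field M).
Proof.
move=> Maut; split; first by move=> a s /Maut [_ [_ [_ [_]]]].
split; first by move=> x y fx fy s Ms; case: (Maut _ Ms) => sD _; rewrite sD fx // fy.
split; first by move=> x fx s Ms; rewrite autN; [rewrite fx|exact: Maut].
split; first by move=> x y fx fy s Ms; rewrite autM; [rewrite fx // fy|exact: Maut].
move=> x fx s Ms; have [f sE] := aut_rmorphism (Maut _ Ms).
by rewrite sE fmorphV -sE fx.
Qed.

Lemma aut_sqrt_sign s e : aut s -> s (e ^+ 2) = e ^+ 2 -> s e = e \/ s e = - e.
Proof.
move=> sA; rewrite autX // => /eqP; rewrite eqf_sqr => /orP[] /eqP ->; first by left.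
by right.
Qed.

Definition finite_orbit x := exists T : seq L, forall s, aut s -> s x \in T.

(** An automorphism sends a square root of [a] to plus or minus the chosen square root of a
    conjugate of [a]. So the elements with finite orbit are closed under square roots, and
    minimality applies. *)
Lemma finite_orbit_all : quadratic_closure iota -> (2%:R : L) != 0 ->
  forall x, finite_orbit x.
Proof.
move=> qL two0; case: (qL) => _ minL.
have sF : subfield_over iota finite_orbit.
  split.
    by move=> a; exists [:: iota a] => s [_ [_ [_ [_ si]]]]; rewrite si mem_head.
  split.
    move=> x y [T xT] [T' yT']; exists [seq u + v | u <- T, v <- T'] => s sA.
    by case: (sA) => sD _; rewrite sD; apply: allpairs_f; [exact: xT|exact: yT'].
  split.
    move=> x [T xT]; exists [seq - u | u <- T] => s sA.
    by rewrite autN //; apply: map_f; exact: xT.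
  split.
    move=> x y [T xT] [T' yT']; exists [seq u * v | u <- T, v <- T'] => s sA.
    by rewrite autM //; apply: allpairs_f; [exact: xT|exact: yT'].
  move=> x [T xT]; exists [seq u^-1 | u <- T] => s sA.
  have [f sE] := aut_rmorphism sA.
  by rewrite sE fmorphV -sE; apply: map_f; exact: xT.
apply: minL => //; apply: (sqrt_quad_closed sF) => // a [T aT].
have [g gE] := choice (quadratic_closure_sqrt qL).
exists (g a); last exact: gE.
exists ([seq g u | u <- T] ++ [seq - g u | u <- T]) => s sA.
have /eqP : s (g a) ^+ 2 = g (s a) ^+ 2 by rewrite gE -(autX sA) gE.
rewrite mem_cat eqf_sqr => /orP[] /eqP ->; apply/orP; [left|right].
  by apply: map_f; exact: aT.
by apply: (map_f (fun u => - g u)); exact: aT.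
Qed.

Lemma finite_orbit_poly (p : {poly L}) : (forall x, finite_orbit x) ->
  exists T : seq {poly L}, forall f : {rmorphism L -> L}, aut f -> map_poly f p \in T.
Proof.
move=> fin; elim/poly_ind: p => [|p c [T pT]].
  by exists [:: 0] => f _; rewrite rmorph0 mem_head.
have [T' cT'] := fin c.
exists [seq q * 'X + d%:P | q <- T, d <- T'] => f fA.
rewrite rmorphD rmorphM /= map_polyX map_polyC.
by apply: allpairs_f; [exact: pT|exact: cT'].
Qed.

(* [S] is encoded as a polynomial over [L], and the product of [Y - q] over the
   [M]-orbit of that polynomial has its coefficients in the fixed field of [M],
   so [s] permutes the orbit as well. *)
Lemma fixed_field_dense M s : (forall x, finite_orbit x) -> aut_subgroup iota M ->
  aut s -> (forall x, fixed_field M x -> s x = x) ->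
  forall S : seq L, exists2 m, M m & forall x, x \in S -> m x = s x.
Proof.
move=> fin [Maut [Mid [MM MV]]] sA sfix S.
pose p := Poly S.
suff [m Mm mp] : exists2 m, M m & forall i, m p`_i = s p`_i.
  exists m => // x /(nthP 0) [i _ <-].
  by have := mp i; rewrite coef_Poly.
have [T pT] := finite_orbit_poly p fin.
pose inorb q := `[< exists2 m : {rmorphism L -> L}, M m & map_poly m p = q >].
pose U := undup [seq q <- T | inorb q].
have memU q : (q \in U) = inorb q.
  rewrite mem_undup mem_filter /inorb; case: asboolP => //= -[m Mm <-].
  by apply: pT; exact: Maut.
pose Q : {poly {poly L}} := \prod_(q <- U) ('X - q%:P).
have Qfix (m : {rmorphism L -> L}) : M m -> map_poly (map_poly m) Q = Q.
  move=> Mm; rewrite rmorph_prod /=.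
  under eq_bigr do rewrite map_polyXsubC.
  rewrite -(big_map (map_poly m) xpredT (fun q => 'X - q%:P)).
  have uM : uniq [seq map_poly m q | q <- U].
    by rewrite map_inj_uniq ?undup_uniq //; exact: map_poly_inj.
  apply: perm_big; apply: uniq_perm => //; first exact: undup_uniq.
  have sub : {subset [seq map_poly m q | q <- U] <= U}.
    move=> _ /mapP [q qU ->]; move: qU; rewrite !memU => /asboolP [n Mn <-].
    apply/asboolP; exists (m \o n); first exact: MM.
    by rewrite map_poly_comp.
  have szM : (size U <= size [seq map_poly m q | q <- U])%N by rewrite size_map.
  have [_ mE] := uniq_min_size uM sub szM.
  by move=> q; rewrite mE.
have [f sE] := aut_rmorphism sA.
have Qs : map_poly (map_poly f) Q = Q.
  apply/polyP => i; rewrite coef_map /=; apply/polyP => j; rewrite coef_map /= -sE.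
  apply: sfix => m Mm; have [h hE] := aut_rmorphism (Maut _ Mm).
  have Mh : M h by rewrite -hE.
  have := congr1 (fun P : {poly {poly L}} => P`_i`_j) (Qfix h Mh).
  by rewrite coef_map /= coef_map hE.
have : root Q p.
  rewrite root_prod_XsubC memU; apply/asboolP; exists idfun => //.
  by rewrite map_poly_id.
move=> /(rmorph_root (map_poly f)); rewrite Qs root_prod_XsubC memU.
move=> /asboolP [m Mm mp]; exists m => // i.
by rewrite sE -!coef_map mp.
Qed.
End Automorphisms.

(** * Subgroups of index two *)

Section Groups.
Variable W : groupType.
Implicit Types (H M : W -> Prop) (w a b : W).
Local Open Scope group_scope.

(** The product condition expresses that [M] has index two. If [H] contains [M] and some [a] outside
    [M], then any [x] outside [M] equals [a^-1 (a x)] with [a x] in [M]. *)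
Lemma maximal_open_of_index2 op M : subgroup M -> op M -> (exists w, ~ M w) ->
  (forall a b, ~ M a -> ~ M b -> M (a * b)) -> maximal_open_subgroup op M.
Proof.
move=> [M1 [MM MV]] opM ex idx; split; first by split.
split=> //; split=> // H [_ [HM HV]] MH.
have [[a [Ha nMa]]|sub] := pselect (exists a, H a /\ ~ M a); last first.
  by left=> x Hx; apply: contrapT => nMx; apply: sub; exists x.
right=> x; have [/MH //|nMx] := pselect (M x).
by rewrite -(mulKg a x); apply: HM; [exact: HV|apply: MH; exact: idx].
Qed.

(** Zorn's lemma gives a subgroup [M] maximal among those containing [H] and avoiding [w]. It
    contains all squares, so it is normal; for [a] outside [M], the group [M] union [aM] must
    contain [w], hence [a] lies in [wM], which is thus the only other coset. *)
Lemma index2_avoiding H w : subgroup H -> (forall x, H (x ^+ 2)) -> ~ H w ->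
  exists M, [/\ subgroup M, forall x, H x -> M x, ~ M w &
    forall a b, ~ M a -> ~ M b -> M (a * b)].
Proof.
move=> sH sqH nHw.
pose Q M := [/\ subgroup M, ~ M w & forall x, H x -> M x].
have [||C [X0 CX0] CQ Ctot|M [[sM nMw _] HM maxM]] := @zorn_above _ Q H.
- by split.
- by exists 1; case: sH.
- have common x y : (exists2 X, C X & X x) -> (exists2 X, C X & X y) ->
      exists2 X, C X & X x /\ X y.
    move=> [K CK Kx] [K' CK' Ky].
    by case: (Ctot _ _ CK CK') => sub; [exists K'|exists K] => //; split=> //; exact: sub.
  split.
  + split; first by exists X0 => //; case: (CQ _ CX0) => [[]].
    split.
      move=> x y Cx Cy; have [X CX [Xx Xy]] := common _ _ Cx Cy.
      by exists X => //; case: (CQ _ CX) => [[_ [XM _]]] _ _; exact: XM.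
    by move=> x [X CX Xx]; exists X => //; case: (CQ _ CX) => [[_ [_ XV]]] _ _; exact: XV.
  + by move=> [X CX]; case: (CQ _ CX).
  + by move=> x Hx; exists X0 => //; case: (CQ _ CX0) => _ _; exact.
exists M; split=> //.
have [M1 [MM MV]] := sM; have sqM x : M (x * x) by apply: HM; exact: sqH.
have normM x m : M m -> M (x^-1 * m * x).
  move=> Mm.
  have -> : x^-1 * m * x = (x^-1 * x^-1) * ((x * m) * (x * m)) * m^-1.
    by rewrite !mulgA mulgVK mulgK.
  by apply/MM; [apply/MM; exact: sqM|exact: MV].
have coset a : ~ M a -> M (a^-1 * w).
  move=> nMa.
  pose N x := M x \/ M (a^-1 * x).
  have Nw : N w.
    apply: contrapT => nNw; apply: nMa.
    apply: (maxM N); last by right; rewrite mulVg.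
      split=> //; last by move=> x /HM; left.
      split; first by left.
      split.
        move=> x y [Mx|Max] [My|May].
        - by left; exact: MM.
        - right; rewrite -(mulVKg a y) mulgA.
          rewrite (_ : _ * _ * _ = (a^-1 * x * a) * (a^-1 * y)); last by rewrite !mulgA.
          by apply/MM => //; exact: normM.
        - by right; rewrite mulgA; exact: MM.
        - left; rewrite (_ : x * y =
            ((a^-1)^-1 * (a^-1 * x) * a^-1) * (a * a) * (a^-1 * y)).
            by apply/MM => //; apply/MM; [exact: normM|exact: sqM].
          by rewrite !mulgA !invgK mulgV mul1g mulgVK mulgK.
      move=> x [Mx|Max]; first by left; exact: MV.
      right; rewrite -invgM.
      rewrite (_ : x * a = a * (a^-1 * x) * a^-1 * (a * a)); last first.
        by rewrite !mulgA mulgV mul1g mulgVK.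
      apply: MV; apply/MM => //.
      by rewrite -{1}(invgK a); exact: normM.
    by move=> x Mx; left.
  by case: Nw.
move=> a b nMa nMb.
rewrite (_ : a * b = a * a * ((a^-1 * w) * (b^-1 * w)^-1)).
  by apply/MM => //; apply/MM; [exact: coset|apply: MV; exact: coset].
by rewrite invgM invgK !mulgA mulgK mulgK.
Qed.

End Groups.

(** * The topology of the W-group *)

Section WGroup.
Variables (F L : fieldType) (iota : {rmorphism F -> L}).
Variables (W : groupType) (pi : (L -> L) -> W).
Hypothesis piQ : W_group_quotient iota pi.
Local Open Scope ring_scope.
Implicit Types (s t : L -> L) (w : W) (H M U : W -> Prop) (e : L).

Notation aut := (is_aut iota).
Local Ltac aut_tac :=
  repeat match goal with |- is_aut _ (_ \o _) => apply: aut_comp end; assumption.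

Notation kernel := (W_kernel iota).
Notation Phi := (frattini (W_open iota pi)).

Lemma piM s t : aut s -> aut t -> pi (s \o t) = (pi s * pi t)%g.
Proof. by case: piQ => pM _; exact: pM. Qed.

(* Plain [rewrite !piM] loops: any [s] unifies with a composition up to eta. *)
Local Ltac pi_tac :=
  repeat match goal with |- context [pi (?f \o ?g)] =>
    rewrite (@piM f g); [|aut_tac|aut_tac] end.

Lemma pi_surj w : exists2 s, aut s & pi s = w.
Proof. by case: piQ => _ [/(_ w) [s []]]; exists s. Qed.

Lemma pi_ker s : aut s -> (pi s = 1%g) <-> kernel s.
Proof. by case: piQ => _ [_]; exact. Qed.

Lemma pi_id : pi id = 1%g.
Proof. by apply/pi_ker; [exact: aut_id|move=> H [_ []]]. Qed.

Lemma pi_inverse s t : aut s -> aut t -> cancel t s -> pi t = (pi s)^-1%g.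
Proof.
move=> sA tA ts; apply/esym/mulg1_eq; rewrite -piM //.
by rewrite (_ : s \o t = id) ?pi_id //; exact/funext.
Qed.

Lemma kernel_closed : krull_closed iota kernel.
Proof.
move=> s sA cl H sH cH gH; apply: (cH) => // S.
by have [t [Nt tS]] := cl S; exists t; split=> //; exact: Nt.
Qed.

Lemma kernel_gen c : W_gens iota c -> kernel c.
Proof. by move=> gc H _ _; apply. Qed.

Lemma pi_expr4 w : (w ^+ 2 ^+ 2 = 1)%g.
Proof.
have [s sA <-] := pi_surj w.
have s4A : aut (s \o s \o s \o s) by aut_tac.
have := (pi_ker s4A).2 (kernel_gen (conj s4A (or_introl _))).
pi_tac.
by rewrite !expg2 mulgA; apply; exists s.
Qed.

Lemma pi_sqr_central w w' : (w ^+ 2 * w' = w' * w ^+ 2)%g.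
Proof.
have [s sA <-] := pi_surj w; have [t tA <-] := pi_surj w'.
have s2A : aut (s \o s) by exact: aut_comp.
have [u [uA tu ut]] := aut_inverse tA.
have [v [vA sv vs]] := aut_inverse s2A.
(* The commutator of [s^2] and [t], one of the generators of the kernel. *)
pose c := v \o u \o (s \o s) \o t.
have cA : aut c by rewrite /c; aut_tac.
have Kc : kernel c.
  apply: kernel_gen; split=> //; right; exists s, t; do 2!split=> //.
  move=> x; rewrite /c /=.
  by have /= -> := vs (u (s (s (t x)))); rewrite ut.
have := (pi_ker cA).2 Kc.
rewrite /c expg2; pi_tac.
rewrite (pi_inverse s2A vA vs) (pi_inverse tA uA ut); pi_tac => E.
apply: (@mulgI _ ((pi s * pi s)^-1 * (pi t)^-1)%g).
by rewrite [LHS]mulgA [LHS]E -!mulgA mulKg mulVg.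
Qed.

(** An element [t] of [M] close to [s] gives [s = t (t^-1 s)], where [t^-1 s] is close to the
    identity and so lies in the open [M]. *)
Lemma krull_open_closed (M : (L -> L) -> Prop) :
  aut_subgroup iota M -> krull_open iota M -> krull_closed iota M.
Proof.
move=> [Maut [Mid [MM MV]]] oM s sA cl.
have [S MS] := oM _ Mid.
have [t [Mt tS]] := cl S.
have [u [uA tu ut]] := aut_inverse (Maut _ Mt).
have -> : s = t \o (u \o s) by apply/funext=> x /=; rewrite ut.
apply: (MM) => //; apply: MS; first exact: aut_comp.
by move=> x xS /=; rewrite -tS // tu.
Qed.

Lemma preim_subgroup M : subgroup M -> aut_subgroup iota (fun s => aut s /\ M (pi s)).
Proof.
move=> [M1 [MM MV]]; split; first by move=> s [].
split; first by split; [exact: aut_id|rewrite pi_id].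
split.
  by move=> s t [sA Ms] [tA Mt]; split; [exact: aut_comp|rewrite piM //; exact: MM].
move=> s t [sA Ms] tA E; split=> //.
by rewrite (pi_inverse sA tA E); exact: MV.
Qed.

Lemma subgroup_open M (S : seq L) : subgroup M ->
  (forall t, aut t -> (forall x, x \in S -> t x = x) -> M (pi t)) -> W_open iota pi M.
Proof.
move=> sM MS s [sA Ms]; exists S => t tA tS; split=> //.
have [u [uA su us]] := aut_inverse sA.
have -> : t = s \o (u \o t) by apply/funext=> x /=; rewrite us.
rewrite piM //; last exact: aut_comp.
case: (sM) => _ [MM _]; apply/MM => //; apply: MS; first exact: aut_comp.
by move=> x xS /=; rewrite tS // su.
Qed.

Definition central_involution w := (forall w', w * w' = w' * w)%g /\ (w ^+ 2 = 1)%g.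

Lemma central_involution_subgroup : subgroup central_involution.
Proof.
split; first by split=> [w'|]; rewrite ?mulg1 ?mul1g ?expg1n.
split.
  move=> x y [xC x2] [yC y2]; split=> [w'|]; first by rewrite -mulgA (yC w') mulgA (xC w') mulgA.
  by rewrite expgMn ?x2 ?y2 ?mulg1 //; exact: xC.
move=> x [xC x2]; split=> [w'|]; last by rewrite expVgn x2 invg1.
by apply: (@mulgI _ x); rewrite mulVKg mulgA xC mulgK.
Qed.

(** Being central of exponent two means that certain commutators and the square lie in the kernel,
    which is closed; these words depend continuously on [s]. *)
Lemma central_involution_closed :
  krull_closed iota (fun s => aut s /\ central_involution (pi s)).
Proof.
move=> s sA cl; split=> //.
have [s' [s'A ss' s's]] := aut_inverse sA.
split=> [w|].
  have [y yA <-] := pi_surj w; have [y' [y'A yy' y'y]] := aut_inverse yA.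
  pose c := s' \o y' \o s \o y.
  have cA : aut c by rewrite /c; aut_tac.
  have : pi c = 1%g.
    apply/(pi_ker cA); apply: (kernel_closed cA) => S.
    (* If [t] agrees with [s] at the points [y x] and [c x], then [t^-1 y^-1 t y] agrees with [c] at
       [x]. *)
    have [t [[tA [tC _]] tE]] := cl (map y S ++ map c S).
    have [t' [t'A tt' t't]] := aut_inverse tA.
    exists (t' \o y' \o t \o y); split.
      have ctA : aut (t' \o y' \o t \o y) by aut_tac.
      apply/(pi_ker ctA); pi_tac.
      rewrite (pi_inverse tA t'A t't) (pi_inverse yA y'A y'y).
      by rewrite -mulgA tC !mulgA mulgVK mulVg.
    move=> x xS /=.
    have -> : t (y x) = s (y x) by apply: tE; rewrite mem_cat map_f.
    have <- : s (c x) = y' (s (y x)) by rewrite /c /= s's.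
    have <- : t (c x) = s (c x) by apply: tE; rewrite mem_cat orbC map_f.
    by rewrite tt'.
  rewrite /c; pi_tac.
  rewrite (pi_inverse sA s'A s's) (pi_inverse yA y'A y'y) => E.
  apply: (@mulgI _ ((pi s)^-1 * (pi y)^-1)%g).
  by rewrite [LHS]mulgA [LHS]E -!mulgA mulKg mulVg.
have s2A : aut (s \o s) by exact: aut_comp.
rewrite expg2 -piM //; apply/(pi_ker s2A); apply: (kernel_closed s2A) => S.
have [t [[tA [_ t2]] tE]] := cl (S ++ map s S).
have t2A : aut (t \o t) by exact: aut_comp.
exists (t \o t); split; first by apply/(pi_ker t2A); rewrite piM // -expg2.
move=> x xS /=.
have -> : t x = s x by apply: tE; rewrite mem_cat xS.
by apply: tE; rewrite mem_cat orbC map_f.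
Qed.

(* If [w] is not a central involution, it is separated from all squares by an
   open subgroup, which enlarges to one of index two still avoiding [w]. *)
Lemma frattini_central_involution w : Phi w -> central_involution w.
Proof.
move=> Phiw; apply: contrapT => nZw.
have [s sA sw] := pi_surj w.
have [S nS] : exists S : seq L, forall t, aut t -> (forall x, x \in S -> t x = s x) ->
    ~ central_involution (pi t).
  apply: contrapT => nS; apply: nZw; rewrite -sw.
  have [|_ //] := central_involution_closed sA.
  move=> S; apply: contrapT => nt; apply: nS; exists S => t tA tE Zt.
  by apply: nt; exists t.
have [Z1 [ZM ZV]] := central_involution_subgroup.
(* The product of the central involutions with the image of the pointwise stabiliser of [S]. It is a
   subgroup containing a neighbourhood of the identity, and the choice of [S] keeps [w] out. *)
pose H v := exists t, [/\ aut t, forall x, x \in S -> t x = x & central_involution (v * pi t)%g].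
have ZH v : central_involution v -> H v.
  by move=> Zv; exists id; split=> //; [exact: aut_id|rewrite pi_id mulg1].
have sH : subgroup H.
  split; first exact: ZH.
  split.
    move=> x y [t [tA tS Zt]] [t' [t'A t'S Zt']]; exists (t' \o t).
    split; [exact: aut_comp|by move=> z zS /=; rewrite tS // t'S|].
    rewrite piM // (_ : (_ * _)%g = (y * pi t') * (x * pi t))%g; first exact: ZM.
    by case: Zt' => C _; rewrite [RHS]mulgA C !mulgA.
  move=> x [t [tA tS Zt]]; have [t' [t'A tt' t't]] := aut_inverse tA.
  exists t'; split=> //; first by move=> z zS; rewrite -{1}(tS z) // tt'.
  rewrite (pi_inverse tA t'A t't); have := ZV _ Zt; rewrite invgM.
  move=> [C Z2]; rewrite (_ : (x^-1 / pi t)%g = ((pi t)^-1 * x^-1)%g); first by split.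
  by apply: (@mulgI _ (pi t)^-1%g); rewrite mulgA C.
have HS t : aut t -> (forall x, x \in S -> t x = x) -> H (pi t).
  move=> tA tS; have [t' [t'A tt' t't]] := aut_inverse tA.
  exists t'; split=> //; first by move=> z zS; rewrite -{1}(tS z) // tt'.
  by rewrite (pi_inverse tA t'A t't) mulgV.
have nHw : ~ H w.
  move=> [t [tA tS Zt]]; apply: (nS (s \o t)).
  - exact: aut_comp.
  - by move=> x xS /=; rewrite tS.
  - by rewrite piM // sw.
have [x|M [sM HM nMw idx]] := index2_avoiding sH _ nHw.
  by apply: ZH; split=> [w'|]; [exact: pi_sqr_central|exact: pi_expr4].
apply: (nMw); apply: Phiw; apply: maximal_open_of_index2 => //.
  by apply: (subgroup_open (S := S)) => // t tA tS; apply: HM; exact: HS.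
by exists w.
Qed.

End WGroup.

(** * Action on square roots and fourth roots *)

Section SquareRoots.
Variables (F L : fieldType) (iota : {rmorphism F -> L}).
Variables (W : groupType) (pi : (L -> L) -> W).
Hypothesis piQ : W_group_quotient iota pi.
Local Open Scope ring_scope.
Hypothesis qL : quadratic_closure iota.
Hypothesis two0 : (2%:R : L) != 0.
Variable i : L.
Hypothesis i2 : i ^+ 2 = -1.
Implicit Types (s t : L -> L) (w : W) (e b : L).

Notation aut := (is_aut iota).
Notation kernel := (W_kernel iota).
Notation Phi := (frattini (W_open iota pi)).
Notation invariant e := (forall s, aut s -> s e = e).

Lemma opp_neq e : e != 0 -> - e != e.
Proof.
move=> e0; rewrite -subr_eq0 -opprD oppr_eq0 -mulr2n -mulr_natr.
by rewrite mulf_neq0.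
Qed.

Lemma aut_i s : aut s -> s i = i \/ s i = - i.
Proof.
move=> sA; apply: (aut_sqrt_sign sA).
by rewrite i2 (autN sA); case: sA => _ [_ [-> _]].
Qed.

Lemma fourth_root s b : aut s -> s (b ^+ 4) = b ^+ 4 ->
  [\/ s b = b, s b = - b, s b = i * b | s b = - (i * b)].
Proof.
move=> sA; rewrite (autX sA) => E.
have /eqP : (s b - b) * (s b + b) * ((s b - i * b) * (s b + i * b)) = 0.
  transitivity ((s b ^+ 2 - b ^+ 2) * (s b ^+ 2 - i ^+ 2 * b ^+ 2)); first by ring.
  by rewrite i2; transitivity (s b ^+ 4 - b ^+ 4); [ring|rewrite E subrr].
rewrite !mulf_eq0 !subr_eq0 !addr_eq0.
by case/orP => /orP[] /eqP; [apply: Or41|apply: Or42|apply: Or43|apply: Or44].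
Qed.

(** If [s b] is [i b] or its opposite, then [s (s b) = i s(i) b], which is [-b] when [s] fixes [i]
    and [b] when [s] negates it. *)
Lemma aut_sqr_sign s b : aut s -> s (b ^+ 4) = b ^+ 4 ->
  s (s b) = b \/ s (s b) = - b.
Proof.
move=> sA sb.
have ii : i * (i * b) = - b by rewrite mulrA -expr2 i2 mulN1r.
case: (fourth_root sA sb) => E; rewrite E.
- by left.
- by left; rewrite (autN sA) E opprK.
- by rewrite (autM sA) E; case: (aut_i sA) => ->; rewrite ?mulNr ii ?opprK; [right|left].
- rewrite (autN sA) (autM sA) E; case: (aut_i sA) => ->; rewrite ?mulNr !mulrN ?mulNr ii ?opprK.
    by right.
  by left.
Qed.

(** The stabiliser of [b] is a closed subgroup, so only the generators matter. Each [x^2] sends [b]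
    to [b] or [-b] and fixes [i]; hence [x^4] fixes [b], and [x^2] commutes with [y] on [b], since
    [y b] is a power of [i] times [b]. *)
Lemma kernel_fixes b n : invariant (b ^+ 4) -> kernel n -> n b = b.
Proof.
move=> fb kn; suff [] : aut n /\ n b = b by [].
apply: (kn (fun s => aut s /\ s b = b)).
- split; first by move=> s [].
  split; first by split=> //; exact: aut_id.
  split.
    by move=> s t [sA sb] [tA tb]; split; [exact: aut_comp|rewrite /= tb sb].
  by move=> s t [sA sb] tA E; split=> //; apply: (aut_inj sA); rewrite sb; exact: E.
- move=> s sA cl; split=> //; have [t [[_ tb] tE]] := cl [:: b].
  by rewrite -tE ?mem_head.
move=> c [cA gc]; split=> //.
have sgn s : aut s -> s (s b) = b \/ s (s b) = - b.
  by move=> sA; apply: aut_sqr_sign => //; exact: fb.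
case: gc => [[x [xA E]]|[x [y [xA [yA E]]]]].
  by rewrite E /=; case: (sgn x xA) => H; rewrite !H ?(autN xA) ?H ?opprK.
have xxi : x (x i) = i.
  by case: (aut_i xA) => H; rewrite H ?(autN xA) H ?opprK.
have xxN e : x (x (- e)) = - x (x e) by rewrite !(autN xA).
have xxM e f : x (x (e * f)) = x (x e) * x (x f) by rewrite !(autM xA).
apply: (aut_inj xA); apply: (aut_inj xA); apply: (aut_inj yA).
have := E b; rewrite /= => ->.
by case: (fourth_root yA (fb y yA)) => Y; case: (sgn x xA) => X;
  rewrite Y ?xxN ?xxM ?xxi !X ?(autN yA) ?Y ?mulrN ?opprK.
Qed.

Lemma kernel_fixes_sqrt e n : invariant (e ^+ 2) -> kernel n -> n e = e.
Proof.
move=> fe; apply: kernel_fixes => s sA.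
by rewrite -[4%N]/(2 * 2)%N exprM (autX sA) fe.
Qed.

Lemma pi_eq_sqrt s t e : aut s -> aut t -> invariant (e ^+ 2) -> pi s = pi t -> s e = t e.
Proof.
move=> sA tA fe E.
have [u [uA tu ut]] := aut_inverse tA.
have usA : aut (u \o s) by exact: aut_comp.
apply: (aut_inj uA); rewrite tu.
apply: (@kernel_fixes_sqrt _ (u \o s) fe); apply/(pi_ker piQ usA).
by rewrite (piM piQ) // E -(piM piQ) // (_ : u \o t = id) ?(pi_id piQ) //; apply/funext.
Qed.

(** A class belongs here as soon as one representative fixes [e]. If [e^2] is invariant, all
    representatives then do, because the kernel fixes [e]. *)
Definition fixes e w := exists2 s, aut s /\ s e = e & pi s = w.

Lemma fixes_pi e s : invariant (e ^+ 2) -> aut s -> fixes e (pi s) <-> s e = e.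
Proof.
move=> fe sA; split=> [[t [tA te] E]|se]; last by exists s.
by rewrite -[RHS]te; apply: pi_eq_sqrt.
Qed.

Lemma fixes_subgroup e : subgroup (fixes e).
Proof.
split; first by exists id; [split=> //; exact: aut_id|exact: (pi_id piQ)].
split.
  move=> _ _ [s [sA se] <-] [t [tA te] <-]; exists (s \o t); last exact: (piM piQ).
  by split; [exact: aut_comp|rewrite /= te se].
move=> _ [s [sA se] <-]; have [t [tA st ts]] := aut_inverse sA.
exists t; last exact: (pi_inverse piQ).
by split=> //; rewrite -{1}se st.
Qed.

(** Every automorphism sends [e] to [e] or [-e], so the stabiliser of [e] is an open subgroup of
    index at most two; if proper, it is maximal and contains [Phi]. *)
Lemma moves_sqrt_notin_frattini e s : invariant (e ^+ 2) -> aut s -> s e <> e ->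
  ~ Phi (pi s).
Proof.
move=> fe sA se; apply: contra_not se => Phis; apply/(fixes_pi fe sA).
apply: contrapT => nfix; apply: (nfix); apply: Phis.
apply: maximal_open_of_index2; first exact: fixes_subgroup.
- apply: (subgroup_open piQ (S := [:: e])); first exact: fixes_subgroup.
  by move=> t tA tE; apply/fixes_pi => //; apply: tE; exact: mem_head.
- by exists (pi s).
move=> a b; have [x xA <-] := pi_surj piQ a; have [y yA <-] := pi_surj piQ b.
rewrite -(piM piQ) // !fixes_pi //; last exact: aut_comp.
case: (aut_sqrt_sign xA (fe x xA)) => // xe _.
case: (aut_sqrt_sign yA (fe y yA)) => // ye _.
by rewrite /= ye (autN xA) xe opprK.
Qed.

(** Take a maximal open [M] missing [pi s], and look for a new square root [e] in the fixed field of
    its preimage. The stabiliser of [e] contains [M] and is proper, so it equals [M], and [s] moves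
    [e]. *)
Lemma notin_frattini_moves_sqrt s : aut s -> ~ Phi (pi s) ->
  exists e, invariant (e ^+ 2) /\ s e <> e.
Proof.
move=> sA nPhi.
have [M [maxM nMs]] : exists M, maximal_open_subgroup (W_open iota pi) M /\ ~ M (pi s).
  by apply: contrapT => nM; apply: nPhi => M maxM; apply: contrapT => nMs; apply: nM; exists M.
have [sM [oM [_ MH]]] := maxM.
pose M' t := aut t /\ M (pi t).
have sM' : aut_subgroup iota M' := preim_subgroup piQ sM.
have [e [Ee fe ne]] : exists e, [/\ fixed_field M' e, invariant (e ^+ 2) & ~ invariant e].
  apply: contrapT => ne.
  (* Without such an [e], the fixed field of [M'] would be that of the whole group. Then [s] would
     be a limit of elements of [M'], and so a member, since open subgroups are closed. *)
  have inv x : fixed_field M' x -> invariant x.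
    apply: (sqrt_closed_eq (K0 := fixed_field aut) qL two0).
    - by apply: fixed_field_subfield.
    - by apply: fixed_field_subfield => t [].
    - by move=> y fy t [tA _]; exact: fy.
    by move=> e Ee fe; apply: contrapT => nfe; apply: ne; exists e.
  have cM' := krull_open_closed sM' oM.
  case: (cM' s sA) => // S.
  have [|m Mm mE] := fixed_field_dense (finite_orbit_all qL two0) sM' sA _ S.
    by move=> x /inv; apply.
  by exists m.
exists e; split=> //.
case: (MH (fixes e)); first exact: fixes_subgroup.
- move=> w; have [t tA <-] := pi_surj piQ w => Mt.
  by apply/(fixes_pi fe tA); apply: Ee.
- by move=> sub se; apply: nMs; apply: sub; apply/fixes_pi.
by move=> all_fix; case: ne => t tA; apply/(fixes_pi fe tA).
Qed.

(* If [s] fixes [i] and moves [e], then [s] moves a square root [b] of [e] to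
   [+-ib], so that [s^2] moves [b], which the kernel does not. *)
Lemma involution_moves_i s : aut s -> (pi s ^+ 2 = 1)%g -> ~ Phi (pi s) -> s i = - i.
Proof.
move=> sA s2 nPhi; case: (aut_i sA) => // si.
have [e [fe se]] := notin_frattini_moves_sqrt sA nPhi.
have seN : s e = - e by case: (aut_sqrt_sign sA (fe s sA)).
have [b be] := quadratic_closure_sqrt qL e.
have b0 : b != 0.
  apply/eqP => b0; apply: se; have [f ->] := aut_rmorphism sA.
  by rewrite -be b0 expr0n rmorph0.
have s2A : aut (s \o s) by exact: aut_comp.
have fb : invariant (b ^+ 4) by move=> t tA; rewrite -[4%N]/(2 * 2)%N exprM be fe.
have : (s \o s) b = b.
  by apply: kernel_fixes => //; apply/(pi_ker piQ s2A); rewrite (piM piQ) // -expg2.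
have /eqP : s b ^+ 2 = (i * b) ^+ 2 by rewrite -(autX sA) be seN exprMn i2 be mulN1r.
have sib : s (i * b) = i * s b by rewrite (autM sA) si.
rewrite eqf_sqr => /orP[] /eqP E; rewrite /= E ?(autN sA) sib E ?mulrN ?opprK;
  by rewrite mulrA -expr2 i2 mulN1r => /eqP; rewrite (negbTE (opp_neq b0)).
Qed.

End SquareRoots.

(** * Maximal formally real subfields *)

Section RealSubfield.
Variables (F L : fieldType) (iota : {rmorphism F -> L}).
Local Open Scope ring_scope.
Implicit Types (K : L -> Prop) (r s t x : L).

Notation subfield := (subfield_over iota).

Inductive sum_of_squares K : L -> Prop :=
| sos_nil : sum_of_squares K 0
| sos_cons x s : K x -> sum_of_squares K s -> sum_of_squares K (x ^+ 2 + s).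

Lemma sos_in K s : subfield K -> sum_of_squares K s -> K s.
Proof.
move=> sK; elim=> [|x {}s Kx _ Ks]; first exact: subfield0 sK.
by case: (sK) => _ [KD _]; apply/KD => //; exact: (subfieldX 2 sK).
Qed.

Lemma sos_sqr K x : K x -> sum_of_squares K (x ^+ 2).
Proof. by move=> Kx; rewrite -[_ ^+ 2]addr0; constructor=> //; exact: sos_nil. Qed.

Lemma sosD K s t : sum_of_squares K s -> sum_of_squares K t -> sum_of_squares K (s + t).
Proof.
by move=> Ss St; elim: Ss => [|x {}s Kx _ IH]; rewrite ?add0r // -addrA; constructor.
Qed.

Lemma sosM K s t : subfield K -> sum_of_squares K s -> sum_of_squares K t ->
  sum_of_squares K (s * t).
Proof.
move=> sK Ss St; case: (sK) => _ [_ [_ [KM _]]].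
elim: Ss => [|x {}s Kx _ IH]; first by rewrite mul0r; exact: sos_nil.
rewrite mulrDl; apply: sosD => //; elim: St => [|y {IH}u Ky _ IH].
  by rewrite mulr0; exact: sos_nil.
by rewrite mulrDr -exprMn; constructor=> //; exact: KM.
Qed.

Lemma sos_div K s t : subfield K -> sum_of_squares K s -> sum_of_squares K t ->
  sum_of_squares K (s / t).
Proof.
move=> sK Ss St; have [->|t0] := eqVneq t 0; first by rewrite invr0 mulr0; exact: sos_nil.
have -> : s / t = s * t * t^-1 ^+ 2 by field.
apply: (sosM sK); first exact: (sosM sK).
apply: sos_sqr; case: (sK) => _ [_ [_ [_ KV]]]; apply: KV; exact: (sos_in sK).
Qed.

Lemma sos_adj K r s : subfield K -> sum_of_squares (adj K r) s ->
  exists p q m, [/\ sum_of_squares K p, sum_of_squares K q, K m &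
    s = p + r ^+ 2 * q + m * r].
Proof.
move=> sK; case: (sK) => _ [KD [_ [KM _]]].
elim=> [|_ {}s [u [v [Ku Kv ->]]] _ [p [q [m [Sp Sq Km ->]]]]].
  exists 0, 0, 0; split; [exact: sos_nil|exact: sos_nil|exact: subfield0 sK|ring].
exists (u ^+ 2 + p), (v ^+ 2 + q), (u * v + u * v + m).
by split; [constructor|constructor|do 2?apply/KD => //; exact: KM|ring].
Qed.

(** Zorn's lemma starting from the image of [F]. An expression of -1 as a sum of squares in the
    union of a chain uses finitely many elements and so already lives in one member. *)
Lemma maximal_formally_real : formally_real F ->
  exists K, [/\ subfield K, ~ sum_of_squares K (-1) &
    forall K', subfield K' -> ~ sum_of_squares K' (-1) ->
      (forall x, K x -> K' x) -> forall x, K' x -> K x].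
Proof.
move=> realF.
pose Q K := subfield K /\ ~ sum_of_squares K (-1).
pose K0 x := exists a, x = iota a.
have [||C exC CQ Ctot|K [[sK rK] _ maxK]] := @zorn_above _ Q K0.
- split.
    split; first by move=> a; exists a.
    split; first by move=> _ _ [a ->] [b ->]; exists (a + b); rewrite rmorphD.
    split; first by move=> _ [a ->]; exists (- a); rewrite rmorphN.
    split; first by move=> _ _ [a ->] [b ->]; exists (a * b); rewrite rmorphM.
    by move=> _ [a ->]; exists a^-1; rewrite fmorphV.
  have seqP x : sum_of_squares K0 x -> exists z : seq F, x = iota (\sum_(y <- z) y ^+ 2).
    elim=> [|_ s [a ->] _ [z ->]]; first by exists [::]; rewrite big_nil rmorph0.
    by exists (a :: z); rewrite big_cons rmorphD rmorphXn.
  move=> /seqP [z zE]; apply: realF; exists z; apply: (fmorph_inj iota).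
  by rewrite -zE rmorphN1.
- by exists 0; exists 0; rewrite rmorph0.
- split; first by apply: subfield_chain => // X CX; case: (CQ X CX).
  have inC s : sum_of_squares (fun x => exists2 X, C X & X x) s ->
      exists2 X, C X & sum_of_squares X s.
    have mono (X Y : L -> Prop) u : (forall x, X x -> Y x) ->
        sum_of_squares X u -> sum_of_squares Y u.
      by move=> XY; elim=> [|x v Xx _ Yv]; constructor=> //; exact: XY.
    elim=> [|x {}s [X CX Xx] _ [Y CY Ys]].
      by case: exC => X CX; exists X => //; exact: sos_nil.
    case: (Ctot _ _ CX CY) => sub.
      by exists Y => //; constructor=> //; exact: sub.
    by exists X => //; constructor=> //; exact: mono Ys.
  by move=> /inC [X CX]; case: (CQ X CX).
exists K; split=> // K' sK' rK' sub; exact: maxK.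
Qed.

Variable K : L -> Prop.
Hypothesis sK : subfield K.
Hypothesis realK : ~ sum_of_squares K (-1).
Hypothesis maxK : forall K', subfield K' -> ~ sum_of_squares K' (-1) ->
  (forall x, K x -> K' x) -> forall x, K' x -> K x.
Hypothesis qL : quadratic_closure iota.
Variable i : L.
Hypothesis i2 : i ^+ 2 = -1.

Lemma char_neq2 : (2%:R : L) != 0.
Proof.
apply/eqP => E; apply: realK.
have -> : -1 = 1 ^+ 2 :> L.
  by apply/esym/eqP; rewrite expr1n -subr_eq0 opprK -[1 + 1]/(2%:R) E.
by apply: sos_sqr; exact: subfield1 sK.
Qed.

Lemma notin_i : ~ K i.
Proof. by move=> Ki; apply: realK; rewrite -i2; exact: sos_sqr. Qed.

(** A square root [r] of [a] generates a strictly larger field, which by maximality is no longer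
    formally real; the coordinates without [r] are compared. *)
Lemma nonsquare_sos a : K a -> ~ (exists2 u, K u & u ^+ 2 = a) ->
  exists p q, [/\ sum_of_squares K p, sum_of_squares K q & -1 = p + a * q].
Proof.
move=> Ka nsq; have [r rE] := quadratic_closure_sqrt qL a.
have nKr : ~ K r by move=> Kr; apply: nsq; exists r.
have Kr2 : K (r ^+ 2) by rewrite rE.
have : sum_of_squares (adj K r) (-1).
  apply: contrapT => nS; apply: nKr.
  apply: (maxK (subfield_adj sK Kr2) nS); last exact: (adj_gen r sK).
  by move=> x; exact: (adj_base r sK).
move=> /(sos_adj sK) [p [q [m [Sp Sq Km E]]]]; exists p, q; split=> //.
case: (sK) => _ [KD [KN [KM _]]].
have K1 := subfield1 sK.
have [pE _] : -1 = p + r ^+ 2 * q /\ 0 = m.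
  apply: (adj_coord sK nKr) => //; last by rewrite mul0r addr0.
  - exact: KN.
  - exact: subfield0 sK.
  by apply/KD; [exact: (sos_in sK)|apply/KM => //; exact: (sos_in sK)].
by rewrite pE rE.
Qed.

(** Otherwise [-1 = p + a q] and [-1 = p' - a q'] with sums of squares of [K]. Eliminating [a] gives
    [-q = q p' + q' (1 + p)], so -1 would be a sum of squares. *)
Lemma sqrt_or_opp a : K a -> exists2 u, K u & a = u ^+ 2 \/ a = - u ^+ 2.
Proof.
move=> Ka; apply: contrapT => nsq; case: (sK) => _ [_ [KN _]].
have [|p [q [Sp Sq E]]] := nonsquare_sos Ka.
  by move=> [u Ku uE]; apply: nsq; exists u => //; left.
have [|p' [q' [Sp' Sq' E']]] := nonsquare_sos (KN _ Ka).
  by move=> [u Ku uE]; apply: nsq; exists u => //; right; rewrite uE opprK.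
have q0 : q != 0 by apply/eqP => q0; apply: realK; rewrite E q0 mulr0 addr0.
apply: realK.
have -> : -1 = (q * p' + q' * (1 + p)) / q.
  apply: (mulIf q0); rewrite divfK // mulN1r; apply/eqP; rewrite eq_sym -subr_eq0 opprK; apply/eqP.
  have -> : 1 + p = - (a * q) by apply/eqP; rewrite -subr_eq0 opprK -addrA -E subrr.
  have -> : p' = a * q' - 1 by rewrite E'; ring.
  by ring.
apply: (sos_div sK) => //; apply: sosD; first exact: (sosM sK).
apply: (sosM sK) => //; apply: sosD => //.
by rewrite -(expr1n _ 2); apply: sos_sqr; exact: subfield1 sK.
Qed.

(** A nonzero [a = - u^2] would make [-1 = a / u^2] a sum of squares. *)
Lemma sqrt_sos a : sum_of_squares K a -> exists2 u, K u & a = u ^+ 2.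
Proof.
move=> Sa; have [u Ku [->|aE]] := sqrt_or_opp (sos_in sK Sa); first by exists u.
have [u0|u0] := eqVneq u 0; first by exists u => //; rewrite aE u0 expr0n oppr0.
case: realK; have -> : -1 = a / u ^+ 2 by rewrite aE; field.
by apply: (sos_div sK) => //; exact: sos_sqr.
Qed.

(** The formula for complex square roots: with [n^2 = x^2 + y^2] and [u^2 = (x + n) / 2], a root of
    [x + y i] is [u + (y / (2 u)) i]. The sign of [n] is chosen so that [(x + n) / 2] is a square in
    [K]. *)
Lemma adj_i_sqrt a : adj K i a -> exists2 r, adj K i r & r ^+ 2 = a.
Proof.
move=> [x [y [Kx Ky ->]]]; case: (sK) => _ [KD [KN [KM KV]]].
have K0 := subfield0 sK; have two0 := char_neq2.
have K2 : K 2%:R by rewrite -(rmorph_nat iota); case: sK.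
have [->|y0] := eqVneq y 0.
  have [u Ku [->|->]] := sqrt_or_opp Kx.
    by exists u; [exact: (adj_base i sK)|ring].
  exists (u * i); first by exists 0, u; split=> //; ring.
  by rewrite exprMn i2; ring.
have [|n Kn nE] := @sqrt_sos (x ^+ 2 + y ^+ 2); first by apply: sosD; exact: sos_sqr.
have main m : K m -> m ^+ 2 = x ^+ 2 + y ^+ 2 ->
    (exists2 u, K u & (x + m) / 2%:R = u ^+ 2) ->
    exists2 r, adj K i r & r ^+ 2 = x + y * i.
  move=> Km mE [u Ku uE].
  have u0 : u != 0.
    apply/eqP => u0; move: y0; rewrite -(sqrf_eq0 y).
    have xm : x + m = 0.
      by apply: (mulIf (invr_neq0 two0)); rewrite mul0r uE u0 expr0n.
    have -> : y ^+ 2 = (m - x) * (x + m) by rewrite -[y ^+ 2](addKr (x ^+ 2)) -mE; ring.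
    by rewrite xm mulr0 eqxx.
  exists (u + (y / (2%:R * u)) * i).
    exists u, (y / (2%:R * u)); split=> //; apply: (subfield_div sK) => //; exact: KM.
  have -> : (u + y / (2%:R * u) * i) ^+ 2 =
     u ^+ 2 + (y ^+ 2) / (4%:R * u ^+ 2) * i ^+ 2 + y * i.
    by field; rewrite u0 two0 -[4%N]/(2 * 2)%N natrM mulf_neq0.
  rewrite i2; congr (_ + _).
  have yE : y ^+ 2 = m ^+ 2 - x ^+ 2 by rewrite mE; ring.
  have xm : x + m != 0.
    by apply: contraNneq u0 => xm; rewrite -(sqrf_eq0 u) -uE xm mul0r.
  by rewrite -uE yE; field; rewrite xm two0 -[4%N]/(2 * 2)%N natrM mulf_neq0.
have [|u Ku [uE|uE]] := @sqrt_or_opp ((x + n) / 2%:R).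
- by apply: (subfield_div sK) => //; exact: KD.
- by apply: (main n) => //; exists u.
(* Since [(x + n) (x - n) = - y^2], the value [(x + n) / 2 = - u^2] turns [(x - n) / 2] into the
   square of [y / (2 u)]. *)
apply: (main (- n)); [exact: KN|by rewrite sqrrN|].
have u0 : u != 0.
  apply/eqP => u0; move: y0; rewrite -(sqrf_eq0 y).
  have xn : x + n = 0.
    by apply: (mulIf (invr_neq0 two0)); rewrite mul0r uE u0 expr0n oppr0.
  have -> : y ^+ 2 = (n - x) * (x + n) by rewrite -[y ^+ 2](addKr (x ^+ 2)) nE; ring.
  by rewrite xn mulr0 eqxx.
exists (y / (2%:R * u)); first by apply: (subfield_div sK) => //; exact: KM.
have -> : (y / (2%:R * u)) ^+ 2 = - (y ^+ 2 / 4%:R) / (- u ^+ 2).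
  by field; rewrite u0 two0 oppr_eq0 sqrf_eq0 u0 -[4%N]/(2 * 2)%N natrM mulf_neq0.
have yE : y ^+ 2 = n ^+ 2 - x ^+ 2 by rewrite -nE; ring.
have xn : x + n != 0.
  apply: contraNneq u0 => xn; rewrite -(sqrf_eq0 u) -oppr_eq0 -uE xn mul0r //.
by rewrite -uE yE; field; rewrite xn two0 -[4%N]/(2 * 2)%N natrM mulf_neq0.
Qed.

Lemma adj_i_all x : adj K i x.
Proof.
case: (sK) => _ [_ [KN _]].
have sKi : subfield (adj K i).
  by apply: (subfield_adj sK); rewrite i2; apply: KN; exact: subfield1 sK.
case: (qL) => _; apply=> //; apply: (sqrt_quad_closed sKi char_neq2).
exact: adj_i_sqrt.
Qed.

Lemma conjugation : exists c, [/\ is_aut iota c, c \o c =1 id & c i = - i].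
Proof.
have ex x : exists z : L, exists u v, [/\ K u, K v, x = u + v * i & z = u - v * i].
  by have [u [v [Ku Kv xE]]] := adj_i_all x; exists (u - v * i), u, v.
have [c cP] := choice ex.
case: (sK) => Ki [KD [KN [KM KV]]]; have K0 := subfield0 sK; have K1 := subfield1 sK.
have cE u v : K u -> K v -> c (u + v * i) = u - v * i.
  move=> Ku Kv; have [u' [v' [Ku' Kv' E ->]]] := cP (u + v * i).
  by have [-> ->] := adj_coord sK notin_i Ku Kv Ku' Kv' E.
have cc : cancel c c.
  move=> x; have [u [v [Ku Kv xE ->]]] := cP x.
  by rewrite -mulNr cE //; [rewrite mulNr opprK|exact: KN].
have cK u : K u -> c u = u.
  by move=> Ku; rewrite -[u in LHS]addr0 -(mul0r i) cE // mul0r subr0.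
exists c; split.
- split=> [x y|].
    have [u [v [Ku Kv -> ->]]] := cP x; have [u' [v' [Ku' Kv' -> ->]]] := cP y.
    have -> : u + v * i + (u' + v' * i) = (u + u') + (v + v') * i by ring.
    by rewrite cE; [ring|exact: KD|exact: KD].
  split=> [x y|].
    have [u [v [Ku Kv -> ->]]] := cP x; have [u' [v' [Ku' Kv' -> ->]]] := cP y.
    have -> : (u + v * i) * (u' + v' * i) = (u * u' + v * v' * i ^+ 2) + (u * v' + v * u') * i.
      by ring.
    rewrite i2 mulrN1 cE.
    - have -> : (u - v * i) * (u' - v' * i) = (u * u' + v * v' * i ^+ 2) - (u * v' + v * u') * i.
        by ring.
      by rewrite i2 mulrN1.
    - by apply/KD; [|apply/KN]; exact: KM.
    - by apply/KD; exact: KM.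
  split; first exact: cK.
  by split; [exists c|move=> a; apply: cK; exact: Ki].
- exact: cc.
by have := cE 0 1 K0 K1; rewrite !mul1r add0r sub0r.
Qed.

End RealSubfield.

(** * Maximal elementary abelian subgroups of the W-group *)

Theorem theorem2p4 (F L : fieldType) (iota : {rmorphism F -> L})
    (W : groupType) (pi : (L -> L) -> W) :
  formally_real F ->
  quadratic_closure iota ->
  W_group_quotient iota pi ->
  let Phi := frattini (W_open iota pi) in
  central Phi /\ elementary_abelian2 Phi /\
  (forall A, maximal_elementary_abelian A -> index_two_in Phi A).
Proof.
move=> realF qL piQ Phi.
have [K [sK rK maxK]] := maximal_formally_real iota realF.
have two0 := char_neq2 sK rK.
have [i i2] := quadratic_closure_sqrt qL (-1)%R.
have Phi_inv w : Phi w -> central_involution w := frattini_central_involution piQ (w:=w).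
have sPhi : subgroup Phi.
  split; first by move=> M [[]].
  split.
    by move=> x y Px Py M MM; case: (MM) => [[_ [MD _]] _]; apply: MD; [exact: Px|exact: Py].
  by move=> x Px M MM; case: (MM) => [[_ [_ MV]] _]; apply: MV; exact: Px.
have elPhi : elementary_abelian2 Phi.
  split=> //; split=> [x y /Phi_inv [C _] _|x /Phi_inv [_]] //.
split; first by move=> x y /Phi_inv [].
split=> // A [[[A1 [AM AV]] [AC A2]] maxA].
(* Since [Phi] is central of exponent two, its product with an elementary abelian [B] is again
   elementary abelian; the maximality of [A] is always used through such products. *)
have join (B : W -> Prop) : elementary_abelian2 B ->
    elementary_abelian2 (fun x => exists b p, [/\ B b, Phi p & x = (b * p)%g]).
  move=> [[B1 [BM BV]] [BC B2]]; have [P1 [PM PV]] := sPhi.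
  have PC p x : Phi p -> (p * x = x * p)%g by move=> /Phi_inv [].
  split.
    split; first by exists 1%g, 1%g; rewrite mulg1.
    split.
      move=> _ _ [b [p [Bb Pp ->]]] [b' [p' [Bb' Pp' ->]]].
      exists (b * b')%g, (p * p')%g; split; [exact: BM|exact: PM|].
      by rewrite -!mulgA (PC p (b' * p')%g) // (PC p p') // !mulgA.
    move=> _ [b [p [Bb Pp ->]]]; exists b^-1%g, p^-1%g.
    by split; [exact: BV|exact: PV|rewrite invgM (PC _ _ (PV _ Pp))].
  split.
    move=> _ _ [b [p [Bb Pp ->]]] [b' [p' [Bb' Pp' ->]]].
    rewrite -!mulgA (PC p (b' * p')%g) // (PC p' (b * p)%g) // !mulgA (BC b b') //.
    by rewrite -!mulgA (PC p p').
  move=> _ [b [p [Bb Pp ->]]]; rewrite expgMn; last exact/esym/PC.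
  by rewrite B2 //; case: (Phi_inv _ Pp) => _ ->; rewrite mulg1.
have PhiA x : Phi x -> A x.
  move=> Px; apply: (maxA _ (join A _)); first by [].
    by move=> y Ay; exists y, 1%g; rewrite mulg1; case: sPhi.
  by exists 1%g, x; rewrite mul1g.
have inv_moves w : A w -> ~ Phi w -> forall s, is_aut iota s -> pi s = w -> s i = (- i)%R.
  move=> Aw nPw s sA sw; rewrite -sw in nPw.
  by apply: (involution_moves_i piQ qL two0 i2 sA) => //; rewrite sw; exact: A2.
split=> //.
have [c [cA cc ci]] := conjugation sK rK maxK qL i2.
have i0 : (i != 0)%R.
  by apply/eqP => i0; move: i2; rewrite i0 expr0n => /eqP; rewrite eq_sym oppr_eq0 oner_eq0.
have nPc : ~ Phi (pi c).
  apply: (moves_sqrt_notin_frattini piQ i2 (e := i)) => //.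
    by move=> s sA; rewrite i2 (autN sA); case: sA => _ [_ [-> _]].
  by rewrite ci => /eqP; rewrite (negbTE (opp_neq two0 i0)).
(* If [A] were inside [Phi], the product of [Phi] with the group generated by the class of the
   conjugation [c] would be an elementary abelian group containing [A], so [pi c] would lie in [A],
   hence in [Phi]. *)
have [a [Aa nPa]] : exists a, A a /\ ~ Phi a.
  apply: contrapT => nA; apply: nPc.
  have AP x : A x -> Phi x by move=> Ax; apply: contrapT => nPx; apply: nA; exists x.
  apply: (AP).
  have elc : elementary_abelian2 (fun x => x = 1%g \/ x = pi c).
    have c2 : (pi c * pi c = 1)%g.
      rewrite -(piM piQ) // (_ : c \o c = id) ?(pi_id piQ) //; exact/funext.
    split.
      split; first by left.
      split.
        by move=> _ _ [->|->] [->|->]; rewrite ?mulg1 ?mul1g ?c2; [left|right|right|left].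
      by move=> _ [->|->]; [left; rewrite invg1|right; exact: mulg1_eq].
    split; first by move=> _ _ [->|->] [->|->]; rewrite ?mulg1 ?mul1g.
    by move=> _ [->|->]; rewrite ?expg1n // expg2.
  apply: (maxA _ (join _ elc)).
    by move=> y /AP Py; exists 1%g, y; split=> //; [left|rewrite mul1g].
  by exists (pi c), 1%g; split; [right|case: sPhi|rewrite mulg1].
exists a; do 2!split=> //; move=> b Ab.
apply: contrapT => nb.
have nPb : ~ Phi b by move=> Pb; apply: nb; left.
have nPab : ~ Phi (a^-1 * b)%g by move=> Pb; apply: nb; right.
have [s sA sa] := pi_surj piQ a; have [t tA tb] := pi_surj piQ b.
have [u [uA su us]] := aut_inverse sA.
have si : s i = (- i)%R := inv_moves _ Aa nPa _ sA sa.
have ti : t i = (- i)%R := inv_moves _ Ab nPb _ tA tb.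
have utA : is_aut iota (u \o t) by exact: aut_comp.
(* As an involution outside [Phi], the class of [s^-1 t] would negate [i]; but [s] and [t] both
   negate [i], so [s^-1 t] fixes it. *)
have : (u \o t) i = (- i)%R.
  apply: (inv_moves _ _ nPab) => //; first by apply: AM => //; exact: AV.
  by rewrite (piM piQ) // (pi_inverse piQ sA uA us) sa tb.
rewrite /= ti -si su => /eqP.
by rewrite eq_sym si (negbTE (opp_neq two0 i0)).
Qed.
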